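(* For every $p\in(0,1]$ and $\varepsilon>0$ there is an $\eta>0$ such that the following holds. If $G=(V,E)$ is a graph satisfying \[ \bigl|\triangle(A,B,V)-p^3|A||B||V|\bigr|\le \eta|V|^3 \] for all subsets $A,B\subseteq V$, then $G$ is $(\varepsilon,p)$-quasirandom.
   Context: Graphs are finite, simple and undirected, with nonempty vertex set. For a graph $G=(V,E)$ and (not necessarily disjoint) subsets $A,B,C\subseteq V$, $\triangle(A,B,C)$ denotes the number of triangles with a vertex in $A$, a vertex in $B$ and a vertex in $C$, counted as ordered triples: it is the number of $(a,b,c)\in A\times B\times C$ with $ab,ac,bc\in E$. For $X,Y\subseteq V$, $e_G(X,Y)$ is the number of ordered pairs $(x,y)\in X\times Y$ with $xy\in E$ (so edges contained in $X\cap Y$ are counted twice). For $\varepsilon>0$ and $p\in(0,1]$, a graph $G=(V,E)$ is called $(\varepsilon,p)$-quasirandom if for all $X,Y\subseteq V$ we have $\bigl|e_G(X,Y)-p|X||Y|\bigr|\le\varepsilon|V|^2$. *)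

(* Defs.v *)
From mathcomp Require Import all_boot all_order all_algebra.
From mathcomp Require Import reals.

Set Implicit Arguments.
Unset Strict Implicit.
Unset Printing Implicit Defensive.

Import Order.TTheory GRing.Theory Num.Theory.
Local Open Scope ring_scope.

(* A finite simple graph with nonempty vertex set is given by a finType V and
   an adjacency relation E satisfying this predicate. *)
Definition simple_graph (V : finType) (E : rel V) : Prop :=
  [/\ symmetric E, irreflexive E & (0 < #|V|)%N].

Definition triangles (V : finType) (E : rel V) (A B C : {set V}) : nat :=
  #|[set t : V * V * V | let: (a, b, c) := t in
      [&& a \in A, b \in B, c \in C, E a b, E a c & E b c]]|.

(* Ordered pairs: an edge inside X :&: Y is counted twice. *)
Definition edges_between (V : finType) (E : rel V) (X Y : {set V}) : nat :=
  #|[set xy : V * V | [&& xy.1 \in X, xy.2 \in Y & E xy.1 xy.2]]|.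

Definition quasirandom (R : realType) (eps p : R) (V : finType) (E : rel V)
    : Prop :=
  forall X Y : {set V},
    `|(edges_between E X Y)%:R - p * #|X|%:R * #|Y|%:R| <= eps * #|V|%:R ^+ 2.

(* Main.v *)
Require Import Defs.
From mathcomp Require Import all_boot all_order all_algebra.
From mathcomp Require Import reals.
From mathcomp Require Import normedtype derive exp.
From mathcomp Require Import ring lra.

(* Write w for the adjacency kernel, k(x,y) for the codegree divided by |V|, and D = w k - p^3;
   the hypothesis says that D is small in cut norm. Averaging over a vertex shows that D k, and
   hence D q(k) for every polynomial q, is then small in cut norm too. Taking for q a truncation
   of the geometric series for 1/k, w is close in cut norm to U = p^3 q(k); taking a truncation
   of the series for ln k, one obtains that
     (w(x,y) w(x,z) w(y,z) - p^3) (ln U(x,y) + ln U(x,z) + ln U(y,z) - ln p^3)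
   has a small average over the triples (x,y,z), because its first factor has almost vanishing
   pair marginals. By the cut norm estimates w may be replaced by U here, and the expression
   becomes (a - b) (ln a - ln b) >= 0 with a = U(x,y) U(x,z) U(y,z) and b = p^3. So a is close
   to b for most triples, which forces k to be close to p^2 in L^1. Then
   p^2 w - p^3 = D + w (p^2 - k) is small in cut norm. *)

Set Implicit Arguments.
Unset Strict Implicit.
Unset Printing Implicit Defensive.

Import Order.TTheory GRing.Theory Num.Theory.
Import numFieldNormedType.Exports.
Local Open Scope ring_scope.

(** * The cut norm and its basic calculus *)

(** Testing on weights in [-1, 1] instead of vertex subsets allows bounded factors such as [w x z],
    with [z] fixed, to be absorbed into [s] and [t]. A bound over subsets yields this form at the
    cost of a factor 4, see [cut_le_sets]. *)
Definition cut_le (R : realFieldType) (V : finType) (D : V -> V -> R) (e : R) : Prop :=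
  forall s t : V -> R, (forall x, `|s x| <= 1) -> (forall y, `|t y| <= 1) ->
    `|\sum_x \sum_y s x * t y * D x y| <= e * #|V|%:R ^+ 2.

Definition codeg (R : realFieldType) (V : finType) (w : V -> V -> R) (x y : V) : R :=
  (\sum_z w x z * w y z) / #|V|%:R.

Definition tri_excess (R : realFieldType) (V : finType) (p : R) (w : V -> V -> R)
    (x y : V) : R :=
  w x y * codeg w x y - p ^+ 3.

Lemma norm_mul_le1 (R : realFieldType) (a b : R) : `|a| <= 1 -> `|b| <= 1 -> `|a * b| <= 1.
Proof. by move=> ha hb; rewrite normrM mulr_ile1. Qed.

Lemma norm_le1 (R : realFieldType) (a : R) : 0 <= a <= 1 -> `|a| <= 1.
Proof. by case/andP=> a0 a1; rewrite ger0_norm. Qed.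

Lemma ler_sum_const (R : realFieldType) (V : finType) (f : V -> R) (c : R) :
  (forall x, f x <= c) -> \sum_x f x <= c * #|V|%:R.
Proof.
move=> hf; apply: (le_trans (ler_sum _ (fun x _ => hf x))).
by rewrite sumr_const mulr_natr.
Qed.

Lemma ler_norm_sum_const (R : realFieldType) (V : finType) (f : V -> R) (c : R) :
  (forall x, `|f x| <= c) -> `|\sum_x f x| <= c * #|V|%:R.
Proof. by move=> hf; apply: (le_trans (ler_norm_sum _ _ _)); apply: ler_sum_const. Qed.

Lemma sum_const_natr (R : realFieldType) (V : finType) (c : R) : \sum_(x : V) c = c * #|V|%:R.
Proof. by rewrite sumr_const mulr_natr. Qed.

Lemma cut_leW (R : realFieldType) (V : finType) (D D' : V -> V -> R) (e e' : R) :
  cut_le D e -> D =2 D' -> e <= e' -> cut_le D' e'.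
Proof.
move=> hD DD' ee' s t hs ht.
rewrite (eq_bigr (fun x => \sum_y s x * t y * D x y)).
  by apply: (le_trans (hD s t hs ht)); rewrite ler_wpM2r ?exprn_ge0.
by move=> x _; apply: eq_bigr => y _; rewrite DD'.
Qed.

Lemma cut_leD (R : realFieldType) (V : finType) (D D' : V -> V -> R) (e e' : R) :
  cut_le D e -> cut_le D' e' -> cut_le (fun x y => D x y + D' x y) (e + e').
Proof.
move=> hD hD' s t hs ht; rewrite mulrDl.
under eq_bigr do [under eq_bigr do rewrite mulrDr; rewrite big_split].
rewrite big_split; apply: (le_trans (ler_normD _ _)).
by rewrite lerD ?hD ?hD'.
Qed.

Lemma cut_leZ (R : realFieldType) (V : finType) (D : V -> V -> R) (c e : R) :
  cut_le D e -> cut_le (fun x y => c * D x y) (`|c| * e).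
Proof.
move=> hD s t hs ht.
under eq_bigr do [under eq_bigr do rewrite mulrCA; rewrite -mulr_sumr].
by rewrite -mulr_sumr normrM -mulrA ler_wpM2l ?hD.
Qed.

Lemma cut_le_norm (R : realFieldType) (V : finType) (D B : V -> V -> R) (e : R) :
  (forall x y, `|D x y| <= B x y) ->
  \sum_x \sum_y B x y <= e * #|V|%:R ^+ 2 -> cut_le D e.
Proof.
move=> hD hB s t hs ht; apply: le_trans hB.
apply: (le_trans (ler_norm_sum _ _ _)); apply: ler_sum => x _.
apply: (le_trans (ler_norm_sum _ _ _)); apply: ler_sum => y _.
by rewrite normrM (le_trans _ (hD x y)) // ler_piMl // norm_mul_le1.
Qed.

Lemma cut_le_weights (R : realFieldType) (V : finType) (D : V -> V -> R) (e S T : R)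
    (s t : V -> R) :
  0 < S -> 0 < T -> cut_le D e ->
  (forall x, `|s x| <= S) -> (forall y, `|t y| <= T) ->
  `|\sum_x \sum_y s x * t y * D x y| <= S * T * e * #|V|%:R ^+ 2.
Proof.
move=> S0 T0 hD hs ht.
have scale (r : V -> R) (M : R) : 0 < M -> (forall x, `|r x| <= M) ->
    forall x, `|r x / M| <= 1.
  by move=> M0 hr x; rewrite normrM normfV (gtr0_norm M0) ler_pdivrMr // mul1r.
have := hD _ _ (scale _ _ S0 hs) (scale _ _ T0 ht).
have -> : \sum_x \sum_y s x / S * (t y / T) * D x y =
    (S * T)^-1 * \sum_x \sum_y s x * t y * D x y.
  rewrite mulr_sumr; apply: eq_bigr => x _; rewrite mulr_sumr; apply: eq_bigr => y _.
  by rewrite invfM; ring.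
by rewrite normrM normfV (gtr0_norm (mulr_gt0 S0 T0)) ler_pdivrMl ?mulr_gt0 // !mulrA.
Qed.

(** * Codegrees and polynomials in the codegree as multipliers *)

Lemma codeg_itv (R : realFieldType) (V : finType) (w : V -> V -> R) :
  (forall x y, 0 <= w x y <= 1) -> forall x y, 0 <= codeg w x y <= 1.
Proof.
move=> hw x y.
have h z : 0 <= w x z * w y z <= 1.
  by have /andP[? ?] := hw x z; have /andP[? ?] := hw y z; rewrite mulr_ge0 ?mulr_ile1.
rewrite /codeg divr_ge0 ?sumr_ge0 //=; last by move=> z _; case/andP: (h z).
have [n0|n0] := posnP #|V|; first by rewrite n0 invr0 mulr0 ler01.
rewrite ler_pdivrMr ?ltr0n //; apply: ler_sum_const => z.
by case/andP: (h z).
Qed.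

Lemma codegC (R : realFieldType) (V : finType) (w : V -> V -> R) (x y : V) :
  codeg w x y = codeg w y x.
Proof. by congr (_ / _); apply: eq_bigr => z _; rewrite mulrC. Qed.

(* Averaging over z, the weights s and t become s * w _ z and t * w _ z. *)
Lemma cut_le_codeg (R : realFieldType) (V : finType) (w D : V -> V -> R) (e : R) :
  (forall x y, 0 <= w x y <= 1) -> (0 < #|V|)%N ->
  cut_le D e -> cut_le (fun x y => codeg w x y * D x y) e.
Proof.
move=> hw n0 hD s t hs ht.
have n0' : 0 < #|V|%:R :> R by rewrite ltr0n.
have -> : \sum_x \sum_y s x * t y * (codeg w x y * D x y) =
    #|V|%:R^-1 * \sum_z \sum_x \sum_y (s x * w x z) * (t y * w y z) * D x y.
  rewrite [in RHS]exchange_big mulr_sumr; apply: eq_bigr => x _.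
  rewrite [in RHS]exchange_big mulr_sumr; apply: eq_bigr => y _.
  rewrite /codeg !mulr_suml !mulr_sumr.
  by apply: eq_bigr => z _; ring.
rewrite normrM normfV (gtr0_norm n0') ler_pdivrMl // mulrC.
apply: ler_norm_sum_const => z; apply: hD => x; apply: norm_mul_le1 => //; exact: norm_le1.
Qed.

(** Horner induction: a factor [codeg w] is free by [cut_le_codeg], and a constant coefficient [c]
    costs its absolute value. Hence [C] depends on the coefficients of [q] alone and is uniform in
    [V], [w] and [D]. *)
Lemma cut_le_poly (R : realFieldType) (q : {poly R}) :
  exists2 C : R, 0 <= C & forall (V : finType) (w D : V -> V -> R) (e : R),
    (forall x y, 0 <= w x y <= 1) -> (0 < #|V|)%N ->
    cut_le D e -> cut_le (fun x y => q.[codeg w x y] * D x y) (C * e).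
Proof.
elim/poly_ind: q => [|q c [C C0 IH]].
  exists 0 => // V w D e _ _ _; apply: (cut_le_norm (B := fun _ _ => 0)).
    by move=> x y; rewrite horner0 mul0r normr0.
  by rewrite !big1 ?mul0r // => x _; rewrite big1.
exists (C + `|c|); first by rewrite addr_ge0.
move=> V w D e hw n0 hD; rewrite mulrDl.
apply: cut_leW (cut_leD (cut_le_codeg hw n0 (IH V w D e hw n0 hD)) (cut_leZ c hD)) _ (lexx _).
by move=> x y; rewrite hornerMXaddC; ring.
Qed.

(** This says that small codegrees are rare. With k the codegree, [w <= 1] gives 1 - k <= 1 - w k =
    (1 - p^3) - D. Multiplying by (1 - k)^N and summing gains a factor 1 - p^3 at each step of the
    induction, up to a sum of D times a polynomial in k. *)
Lemma sum_gap_pow (R : realFieldType) (p : R) (N : nat) : 0 <= p <= 1 ->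
  exists2 C : R, 0 <= C & forall (V : finType) (w : V -> V -> R) (e : R),
    (forall x y, 0 <= w x y <= 1) -> (0 < #|V|)%N ->
    cut_le (tri_excess p w) e ->
    \sum_x \sum_y (1 - codeg w x y) ^+ N
      <= ((1 - p ^+ 3) ^+ N + C * e) * #|V|%:R ^+ 2.
Proof.
move=> /andP[p0 p1].
have P1 : 0 <= 1 - p ^+ 3 by rewrite subr_ge0 exprn_ile1.
elim: N => [|N [C C0 IH]].
  exists 0 => // V w e _ _ _.
  by under eq_bigr do rewrite sum_const_natr; rewrite sum_const_natr !expr0; lra.
have [C' C'0 hC'] := cut_le_poly ((1 - 'X) ^+ N : {poly R}).
exists ((1 - p ^+ 3) * C + C'); first by rewrite addr_ge0 ?mulr_ge0.
move=> V w e hw n0 hD.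
have m1 : `|-1| <= 1 :> R by rewrite normrN normr1.
have m1' : `|1| <= 1 :> R by rewrite normr1.
have h1 := ler_normlW (hC' V w _ e hw n0 hD (fun _ => -1) (fun _ => 1)
  (fun _ => m1) (fun _ => m1')).
have h2 := IH V w e hw n0 hD.
have h3 : \sum_x \sum_y (1 - codeg w x y) ^+ N.+1 <=
   (1 - p ^+ 3) * (\sum_x \sum_y (1 - codeg w x y) ^+ N) +
   \sum_x \sum_y -1 * 1 * (((1 - 'X) ^+ N).[codeg w x y] * tri_excess p w x y).
  rewrite mulr_sumr -big_split; apply: ler_sum => x _ /=.
  rewrite mulr_sumr -big_split; apply: ler_sum => y _ /=.
  rewrite horner_exp hornerD hornerN hornerX hornerC /tri_excess exprS.
  have /andP[k0 k1] := codeg_itv hw x y; have /andP[w0 w1] := hw x y.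
  have : 0 <= (1 - codeg w x y) ^+ N * (codeg w x y * (1 - w x y)).
    by apply: mulr_ge0; [rewrite exprn_ge0 ?subr_ge0 | apply: mulr_ge0; rewrite ?subr_ge0].
  move: ((1 - codeg w x y) ^+ N) => a H; rewrite -subr_ge0; move: H; congr (_ <= _); ring.
apply: (le_trans h3).
apply: (le_trans (lerD (ler_wpM2l P1 h2) h1)).
by rewrite (exprS _ N) le_eqVlt; apply/orP; left; apply/eqP; ring.
Qed.

(** * The truncated inverse and the approximating kernel *)

(** Partial sum of the geometric series of 1/x around 1; as an approximation of 1/x it has relative
    error (1 - x)^N. *)
Definition inv_poly (R : realFieldType) (N : nat) : {poly R} := \sum_(i < N) (1 - 'X) ^+ i.

Lemma mul_inv_poly (R : realFieldType) (N : nat) (x : R) :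
  x * (inv_poly R N).[x] = 1 - (1 - x) ^+ N.
Proof.
rewrite -[RHS]opprB subrX1 -mulNr opprB subKr horner_sum; congr (_ * _).
by apply: eq_bigr => i _; rewrite horner_exp hornerD hornerN hornerX hornerC.
Qed.

Lemma inv_poly_itv (R : realFieldType) (N : nat) (x : R) :
  0 <= x <= 1 -> 0 <= (inv_poly R N).[x] <= N%:R.
Proof.
move=> /andP[x0 x1]; rewrite horner_sum.
have h (i : 'I_N) : 0 <= ((1 - 'X) ^+ i).[x] <= 1.
  rewrite horner_exp hornerD hornerN hornerX hornerC.
  by rewrite exprn_ge0 ?exprn_ile1 ?subr_ge0 ?gerBl.
rewrite sumr_ge0 => [|i _]; last by case/andP: (h i).
rewrite -[X in _ <= X%:R]card_ord -sum1_card natr_sum; apply: ler_sum => i _.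
by case/andP: (h i).
Qed.

Definition tri (R : realFieldType) (V : finType) (f : V -> V -> R) (x y z : V) : R :=
  f x y * f x z * f y z.

Definition approx_kernel (R : realFieldType) (V : finType) (p : R) (N : nat)
    (w : V -> V -> R) (x y : V) : R :=
  p ^+ 3 * (inv_poly R N).[codeg w x y].

Lemma approx_kernel_itv (R : realFieldType) (V : finType) (p : R) (N : nat)
    (w : V -> V -> R) (x y : V) :
  0 <= p <= 1 -> (forall x y, 0 <= w x y <= 1) ->
  0 <= approx_kernel p N w x y <= N%:R.
Proof.
move=> /andP[p0 p1] hw; rewrite /approx_kernel.
have /andP[a b] := inv_poly_itv N (codeg_itv hw x y).
by rewrite mulr_ge0 ?exprn_ge0 //= (le_trans (ler_wpM2r a (exprn_ile1 3 p0 p1))) ?mul1r.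
Qed.

(** With q = [inv_poly R N] and k the codegree, w - U = q(k) D + w (1 - k)^N. After multiplication
    by h(k), the first term is handled by [cut_le_poly], and the second is small even in L^1 by
    [sum_gap_pow]. *)
Lemma cut_le_approx (R : realFieldType) (p H : R) (N : nat) (h : {poly R}) :
  0 <= p <= 1 -> (forall x, 0 <= x <= 1 -> `|h.[x]| <= H) ->
  exists2 C : R, 0 <= C & forall (V : finType) (w : V -> V -> R) (e : R),
    (forall x y, 0 <= w x y <= 1) -> (0 < #|V|)%N ->
    cut_le (tri_excess p w) e ->
    cut_le (fun x y => h.[codeg w x y] * (w x y - approx_kernel p N w x y))
      (H * (1 - p ^+ 3) ^+ N + C * e).
Proof.
move=> hp hH.
have H0 : 0 <= H by apply: (le_trans (normr_ge0 h.[0])); rewrite hH ?lexx ?ler01.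
have [C1 C10 h1] := cut_le_poly (inv_poly R N * h).
have [C2 C20 h2] := sum_gap_pow N hp.
exists (C1 + H * C2); first by rewrite addr_ge0 ?mulr_ge0.
move=> V w e hw n0 hD.
have h3 : cut_le (fun x y => w x y * (1 - codeg w x y) ^+ N * h.[codeg w x y])
    (H * ((1 - p ^+ 3) ^+ N + C2 * e)).
  apply: (cut_le_norm (B := fun x y => H * (1 - codeg w x y) ^+ N)) => [x y|].
    rewrite mulrC normrM ler_pM ?hH ?codeg_itv //.
    have /andP[k0 k1] := codeg_itv hw x y; have /andP[w0 w1] := hw x y.
    have g0 : 0 <= (1 - codeg w x y) ^+ N by rewrite exprn_ge0 ?subr_ge0.
    by rewrite ger0_norm ?mulr_ge0 // ler_piMl.
  under eq_bigr do rewrite -mulr_sumr; rewrite -mulr_sumr -mulrA.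
  by apply: ler_wpM2l => //; apply: h2.
apply: cut_leW (cut_leD (h1 V w _ e hw n0 hD) h3) _ _.
  move=> x y; rewrite hornerM /tri_excess /approx_kernel.
  have := mul_inv_poly N (codeg w x y).
  set a := (1 - _) ^+ N; set q := (inv_poly R N).[_] => E.
  by have -> : a = 1 - codeg w x y * q; [rewrite E subKr | ring].
by rewrite le_eqVlt; apply/orP; left; apply/eqP; ring.
Qed.

(** The kernel [w] is exchanged for its approximation one edge of the triple at a time. In each
    exchange the vertex off that edge is fixed, and the remaining factors are weights of a cut norm
    estimate. *)
Lemma triple_sum_approx (R : realFieldType) (p H : R) (N : nat) (h : {poly R}) :
  0 <= p <= 1 -> (0 < N)%N -> 0 < H -> (forall x, 0 <= x <= 1 -> `|h.[x]| <= H) ->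
  exists2 C : R, 0 <= C & forall (V : finType) (w : V -> V -> R) (e : R),
    (forall x y, 0 <= w x y <= 1) -> (0 < #|V|)%N -> 0 <= e ->
    cut_le (tri_excess p w) e ->
    `|\sum_x \sum_y \sum_z (tri (approx_kernel p N w) x y z - p ^+ 3) * h.[codeg w x y]|
      <= (3 * N%:R ^+ 2 * H * (1 - p ^+ 3) ^+ N + C * e) * #|V|%:R ^+ 3.
Proof.
move=> hp N0 H0 hH.
have [C1 C10 h1] := cut_le_approx N hp hH.
have [C2 C20 h2] : exists2 C : R, 0 <= C & forall (V : finType) (w : V -> V -> R) (e : R),
    (forall x y, 0 <= w x y <= 1) -> (0 < #|V|)%N ->
    cut_le (tri_excess p w) e ->
    cut_le (fun x y => w x y - approx_kernel p N w x y)
      ((1 - p ^+ 3) ^+ N + C * e).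
  have [|C C0 hC] := @cut_le_approx R p 1 N 1 hp.
    by move=> x _; rewrite hornerC normr1.
  exists C => // V w e hw n0 hD.
  apply: (cut_leW (hC V w e hw n0 hD)); last by rewrite mul1r.
  by move=> x y; rewrite hornerC mul1r.
have [C3 C30 h3] := cut_le_poly h.
exists (C3 + H * C2 + H * N%:R * C2 + N%:R ^+ 2 * C1).
  by rewrite !addr_ge0 ?mulr_ge0 ?exprn_ge0 // ltW.
move=> V w e hw n0 e0 hD.
have {}h1 := h1 V w e hw n0 hD; have {}h2 := h2 V w e hw n0 hD.
have {}h3 := h3 V w _ e hw n0 hD.
set U := approx_kernel p N w in h1 h2 *.
have N1 : 1 <= N%:R :> R by rewrite ler1n.
have N0' : 0 < N%:R :> R by rewrite ltr0n.
have hU x y : `|U x y| <= N%:R.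
  by have /andP[a b] := approx_kernel_itv N x y hp hw; rewrite ger0_norm.
have hw1 x y : `|w x y| <= 1 by exact: norm_le1.
have hh x y : `|h.[codeg w x y]| <= H by rewrite hH // codeg_itv.
set b := (1 - p ^+ 3) ^+ N in h1 h2 *.
have b0 : 0 <= b.
  by case/andP: hp => p0 p1; rewrite exprn_ge0 // subr_ge0 exprn_ile1.
set n : R := #|V|%:R in h1 h2 h3 *.
(* [S0] is the sum for [w] itself: summing over [z] turns its bracket into |V| times [tri_excess].
   [S1], [S2] and [S3] exchange the edges xz, yz and xy. In [S3] the factor [h] sits on the
   exchanged edge, so it has to be part of the kernel; this is why [cut_le_approx] carries [h]. *)
pose S0 := \sum_x \sum_y \sum_z h.[codeg w x y] * (tri w x y z - p ^+ 3).
pose S1 := \sum_y \sum_x \sum_z w x y * h.[codeg w x y] * w y z * (w x z - U x z).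
pose S2 := \sum_x \sum_y \sum_z w x y * h.[codeg w x y] * U x z * (w y z - U y z).
pose S3 := \sum_z \sum_x \sum_y U x z * U y z * (h.[codeg w x y] * (w x y - U x y)).
have -> : \sum_x \sum_y \sum_z (tri U x y z - p ^+ 3) * h.[codeg w x y] =
    S0 - S1 - S2 - S3.
  rewrite /S1 /S3 [X in _ = _ - X - _ - _]exchange_big [X in _ = _ - X]exchange_big /= -!sumrB.
  apply: eq_bigr => x _; rewrite [X in _ = _ - X]exchange_big /= -!sumrB.
  apply: eq_bigr => y _; rewrite -!sumrB; apply: eq_bigr => z _.
  by rewrite /tri; ring.
have B0 : `|S0| <= C3 * e * n ^+ 3.
  have -> : S0 = n * \sum_x \sum_y 1 * 1 * (h.[codeg w x y] * tri_excess p w x y).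
    rewrite mulr_sumr; apply: eq_bigr => x _; rewrite mulr_sumr; apply: eq_bigr => y _.
    rewrite -mulr_sumr sumrB sum_const_natr /tri.
    under eq_bigr do rewrite -mulrA; rewrite -mulr_sumr /tri_excess /codeg -/n.
    have : n != 0 by rewrite pnatr_eq0 -lt0n.
    by move=> ?; field.
  rewrite normrM ger0_norm ?ler0n // exprS [in leRHS]mulrCA ler_wpM2l ?ler0n //.
  by apply: h3 => _; rewrite normr1.
have B1 : `|S1| <= H * 1 * (b + C2 * e) * n ^+ 2 * n.
  apply: ler_norm_sum_const => y.
  apply: cut_le_weights => // x; by rewrite normrM mulrC -[H]mulr1 ler_pM.
have B2 : `|S2| <= H * N%:R * (b + C2 * e) * n ^+ 2 * n.
  apply: ler_norm_sum_const => x.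
  apply: cut_le_weights => // y; by rewrite normrM mulrC -[H]mulr1 ler_pM.
have B3 : `|S3| <= N%:R * N%:R * (H * b + C1 * e) * n ^+ 2 * n.
  by apply: ler_norm_sum_const => z; apply: cut_le_weights.
have T : `|S0 - S1 - S2 - S3| <= `|S0| + `|S1| + `|S2| + `|S3|.
  apply: (le_trans (ler_normB _ _)); rewrite lerD2r.
  apply: (le_trans (ler_normB _ _)); rewrite lerD2r.
  exact: ler_normB.
apply: (le_trans T); apply: (le_trans (lerD (lerD (lerD B0 B1) B2) B3)).
(* The coefficient of H b in the collected bounds is 1 + N + N^2, and 3 N^2 exceeds it by (N - 1)(2
   N + 1). *)
rewrite -subr_ge0.
have -> : (3 * N%:R ^+ 2 * H * b + (C3 + H * C2 + H * N%:R * C2 + N%:R ^+ 2 * C1) * e) *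
    n ^+ 3 - (C3 * e * n ^+ 3 + H * 1 * (b + C2 * e) * n ^+ 2 * n +
     H * N%:R * (b + C2 * e) * n ^+ 2 * n + N%:R * N%:R * (H * b + C1 * e) * n ^+ 2 * n) =
   H * b * n ^+ 3 * ((N%:R - 1) * (2 * N%:R + 1)) by ring.
apply: mulr_ge0; first by apply: mulr_ge0; [rewrite mulr_ge0 // ltW | rewrite exprn_ge0].
by apply: mulr_ge0; lra.
Qed.

(** * The truncated logarithm *)

(** Taylor polynomial of [ln] at 1, of degree [N], so that its derivative is exactly
    [inv_poly R N]. *)
Definition log_poly (R : realType) (N : nat) : {poly R} :=
  - \sum_(i < N) i.+1%:R^-1 *: (1 - 'X) ^+ i.+1.

Lemma deriv_log_poly (R : realType) (N : nat) : (log_poly R N)^`() = inv_poly R N.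
Proof.
rewrite /log_poly derivN raddf_sum -sumrN; apply: eq_bigr => i _ /=.
rewrite derivZ deriv_exp derivB derivX -polyC1 derivC sub0r.
rewrite polyC1 mulN1r mulNrn scalerN opprK /=.
by rewrite -[X in _ *: X]scaler_nat scalerA mulVf ?pnatr_eq0 // scale1r.
Qed.

Lemma log_poly_norm (R : realType) (N : nat) (x : R) :
  0 <= x <= 1 -> `|(log_poly R N).[x]| <= N%:R.
Proof.
move=> /andP[x0 x1]; rewrite hornerN normrN horner_sum.
rewrite -[X in _ <= X%:R]card_ord; rewrite -[leRHS]mul1r; apply: ler_norm_sum_const => i.
rewrite hornerZ horner_exp hornerD hornerN hornerX hornerC.
apply: norm_mul_le1; apply: norm_le1.
  by rewrite invr_ge0 ler0n invf_le1 ?ler1n.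
by rewrite exprn_ge0 ?exprn_ile1 ?subr_ge0 ?gerBl.
Qed.

(** The difference between the polynomial and [ln] vanishes at 1 and has derivative -(1 - t)^N / t;
    the mean value theorem on [x, 1] gives both bounds. *)
Lemma log_poly_approx (R : realType) (N : nat) (c x : R) : 0 < c -> c <= x <= 1 ->
  0 <= (log_poly R N).[x] - ln x <= (1 - c) ^+ N / c.
Proof.
move=> c0 /andP[cx x1].
have x0 : 0 < x by exact: lt_le_trans cx.
pose f t : R := (log_poly R N).[t] - ln t.
have df (t : R) : 0 < t -> is_derive t 1 f ((inv_poly R N).[t] - t^-1).
  move=> t0. rewrite -deriv_log_poly.
  by apply: is_deriveB; exact: is_derive1_ln.
have [||y] := @MVT_segment R f (fun t => (inv_poly R N).[t] - t^-1) x 1 x1.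
- move=> t /itvP ht; apply: df. by apply: lt_trans x0 _; rewrite ht.
- apply: derivable_within_continuous => t /itvP ht.
  have t0 : 0 < t by apply: lt_le_trans x0 _; rewrite ht.
  by have [] := df t t0.
rewrite in_itv /= => /andP[xy y1].
have y0 : 0 < y by exact: lt_le_trans xy.
have -> : f 1 = 0.
  rewrite /f ln1 subr0 hornerN horner_sum big1 ?oppr0 // => i _.
  by rewrite hornerZ horner_exp hornerD hornerN hornerX hornerC subrr expr0n mulr0.
have -> : (inv_poly R N).[y] - y^-1 = - ((1 - y) ^+ N / y).
  have := mul_inv_poly N y; set q := _.[y] => E.
  have -> : (1 - y) ^+ N = 1 - y * q by rewrite E subKr.
  have yn : y != 0 by rewrite gt_eqF.
  by field.
rewrite sub0r mulNr => /oppr_inj; rewrite -/(f x) => ->.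
have g0 : 0 <= (1 - y) ^+ N by rewrite exprn_ge0 ?subr_ge0.
apply/andP; split; first by rewrite mulr_ge0 ?subr_ge0 // divr_ge0 // ltW.
rewrite -[leRHS]mulr1 ler_pM ?subr_ge0 //; last by rewrite gerBl ltW.
  by rewrite divr_ge0 // ltW.
have cy : c <= y by exact: le_trans xy.
apply: ler_pM => //; first by rewrite invr_ge0 ltW.
  by apply: lerXn2r; rewrite ?nnegrE ?subr_ge0 ?lerB // (le_trans cy).
by rewrite lef_pV2.
Qed.

(** * Pointwise lower bound for the logarithmic test expression *)

(** On (0, 1] the logarithm has slope at least 1: for b <= a, ln(b/a) <= b/a - 1 gives ln a - ln b
    >= (a - b)/a >= a - b. *)
Lemma ln_diff_mul (R : realType) (a b : R) : 0 < a <= 1 -> 0 < b <= 1 ->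
  (a - b) ^+ 2 <= (a - b) * (ln a - ln b).
Proof.
wlog : a b / b <= a => [W ha hb|ba /andP[a0 a1] /andP[b0 b1]].
  have [/W|/ltW/W] := leP b a; first exact.
  by move=> /(_ hb ha); rewrite -(opprB a b) -(opprB (ln a)) sqrrN mulrNN.
rewrite expr2 ler_wpM2l ?subr_ge0 //.
have := le_ln1Dx (x := b / a - 1); rewrite subrKC ln_div ?posrE // => h.
have {}h : ln b - ln a <= b / a - 1 by apply: h; rewrite ltrBrDr addrC subrr divr_gt0.
have : (a - b) * 1 <= (a - b) * a^-1 by rewrite ler_wpM2l ?subr_ge0 // invf_ge1.
have : (a - b) * a^-1 = 1 - b / a by rewrite mulrBl mulfV ?gt_eqF.
lra.
Qed.

(* Summed over a triple of values x, y, z this approximates ln (p ^+ 6) - ln (x * y * z). *)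
Definition log_test (R : realType) (p : R) (N : nat) : {poly R} :=
  (2 * ln p)%:P - log_poly R N.

Lemma log_test_norm (R : realType) (p : R) (N : nat) (x : R) :
  0 <= x <= 1 -> `|(log_test p N).[x]| <= N%:R + `|2 * ln p|.
Proof.
move=> hx; rewrite hornerD hornerN hornerC.
apply: (le_trans (ler_normB _ _)); rewrite addrC lerD2r.
exact: log_poly_norm.
Qed.

(** Away from 0 both truncations are accurate. With exact inverses and logarithms the test
    expression is (p^3/u) (p^6 - u) (ln p^6 - ln u) for u = xyz, and [ln_diff_mul] with u <= 1
    bounds it below by the square. The right-hand side pays for the truncation errors. *)
Lemma excess_log_good (R : realType) (p c H : R) (N : nat) (x y z : R) :
  0 < p <= 1 -> 0 < c < 1 ->
  (forall x, 0 <= x <= 1 -> `|(log_test p N).[x]| <= H) ->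
  c <= x <= 1 -> c <= y <= 1 -> c <= z <= 1 ->
  p ^+ 3 * (x * y * z - p ^+ 6) ^+ 2 -
    ((p ^+ 3 * (inv_poly R N).[x]) * (p ^+ 3 * (inv_poly R N).[y]) *
     (p ^+ 3 * (inv_poly R N).[z]) - p ^+ 3) *
    ((log_test p N).[x] + (log_test p N).[y] + (log_test p N).[z]) <=
  (c^-1 ^+ 3 + 1) * (3 * ((1 - c) ^+ N / c)) + 3 * (1 - c) ^+ N * c^-1 ^+ 3 * (3 * H).
Proof.
move=> /andP[p0 p1] /andP[c0 c1] hH hx hy hz.
set d := (1 - c) ^+ N.
have d0 : 0 <= d by rewrite exprn_ge0 // subr_ge0 ltW.
(* [a] is the relative error of the truncated inverse at [t], and [g] the additive error of the
   truncated logarithm. *)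
have data t : c <= t <= 1 -> exists a g : R,
    [/\ 0 < t, 0 <= a <= d /\ a <= 1, (inv_poly R N).[t] = (1 - a) / t,
        0 <= g <= d / c & (log_test p N).[t] = 2 * ln p - ln t - g].
  move=> ht; exists ((1 - t) ^+ N), ((log_poly R N).[t] - ln t).
  have /andP[ct t1] := ht.
  have t0 : 0 < t by exact: lt_le_trans ct.
  have tn : t != 0 by rewrite gt_eqF.
  split => //.
  - rewrite exprn_ge0 ?exprn_ile1 ?subr_ge0 ?gerBl ?(ltW t0) //=; split=> //.
    by apply: lerXn2r; rewrite ?nnegrE ?subr_ge0 ?lerB // (le_trans ct).
  - by rewrite -mul_inv_poly; field.
  - exact: log_poly_approx.
  - by rewrite hornerD hornerN hornerC; ring.
have hh t : c <= t <= 1 -> `|(log_test p N).[t]| <= H.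
  by move=> /andP[ct t1]; rewrite hH // t1 (le_trans (ltW c0)).
have Hx := hh x hx; have Hy := hh y hy; have Hz := hh z hz.
have [ax [gx [x0 [hax ax1] Ex hgx Lx]]] := data x hx.
have [ay [gy [y0 [hay ay1] Ey hgy Ly]]] := data y hy.
have [az [gz [z0 [haz az1] Ez hgz Lz]]] := data z hz.
have Hs : `|(log_test p N).[x] + (log_test p N).[y] + (log_test p N).[z]| <= 3 * H.
  apply: (le_trans (ler_normD _ _)).
  have := ler_normD (log_test p N).[x] (log_test p N).[y].
  by move: Hx Hy Hz; lra.
set S := _ + _ + _.[z] in Hs *.
rewrite Ex Ey Ez.
have vpos t : c <= t -> 0 <= t^-1 <= c^-1.
  move=> ct; have t0 : 0 < t by exact: lt_le_trans ct.
  by rewrite invr_ge0 ltW //= lef_pV2.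
have [/vpos/andP[x0' xc] x1] := andP hx.
have [/vpos/andP[y0' yc] y1] := andP hy.
have [/vpos/andP[z0' zc] z1] := andP hz.
pose u := x * y * z.
have u0 : 0 < u by rewrite !mulr_gt0.
have u1 : u <= 1.
  by rewrite /u mulr_ile1 ?mulr_ge0 ?mulr_ile1 ?(ltW x0) ?(ltW y0) ?(ltW z0).
(* [X] and [L] are the values that the product of the three approximate kernel values and the sum of
   the three test values would have without truncation; [g] is the total error of the logarithms. *)
pose X := p ^+ 9 / u; pose L := ln (p ^+ 6) - ln u; pose g := gx + gy + gz.
have ES : S = L - g.
  rewrite /S Lx Ly Lz /L /g /u lnXn // (lnM (x := x * y)) ?posrE ?mulr_gt0 // lnM ?posrE //.
  by rewrite -mulr_natl; ring.
have hg : `|g| <= 3 * (d / c).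
  move: hgx hgy hgz => /andP[? ?] /andP[? ?] /andP[? ?].
  by rewrite ger0_norm ?addr_ge0 // /g; lra.
(* [r] is the relative error of the product of three truncated inverses. *)
pose r := 1 - (1 - ax) * (1 - ay) * (1 - az).
have hr : 0 <= r <= 3 * d.
  move: hax hay haz => /andP[? ?] /andP[? ?] /andP[? ?].
  rewrite /r; apply/andP; split.
    rewrite subr_ge0; apply: mulr_ile1; rewrite ?mulr_ge0 ?subr_ge0 ?gerBl //.
    by apply: mulr_ile1; rewrite ?subr_ge0 ?gerBl.
  suff : 1 - ax - ay - az <= (1 - ax) * (1 - ay) * (1 - az) by lra.
  have h1 : 0 <= ax * ay by rewrite mulr_ge0.
  have h2 : 1 - ax - ay <= (1 - ax) * (1 - ay) by lra.
  have h3 : (1 - ax - ay) * (1 - az) <= (1 - ax) * (1 - ay) * (1 - az).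
    by rewrite ler_wpM2r ?subr_ge0.
  have h4 : 0 <= (ax + ay) * az by rewrite mulr_ge0 ?addr_ge0.
  by lra.
have X0 : 0 <= X by rewrite divr_ge0 ?exprn_ge0 ?ltW.
have Xc : X <= c^-1 ^+ 3.
  rewrite /X -[leRHS]mul1r; apply: ler_pM.
  - by rewrite exprn_ge0 // ltW.
  - by rewrite invr_ge0 ltW.
  - by rewrite exprn_ile1 // ltW.
  rewrite /u !invfM exprS expr2 -mulrA.
  by rewrite ler_pM ?mulr_ge0 // ler_pM.
have P01 : 0 <= p ^+ 3 <= 1 by rewrite exprn_ge0 ?exprn_ile1 // ltW.
have hXP : `|X - p ^+ 3| <= c^-1 ^+ 3 + 1.
  apply: (le_trans (ler_normB _ _)); case/andP: P01 => a b.
  by rewrite (ger0_norm X0) (ger0_norm a) lerD.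
have main : p ^+ 3 * (u - p ^+ 6) ^+ 2 <= (X - p ^+ 3) * L.
  have un : u != 0 by rewrite gt_eqF.
  have -> : (X - p ^+ 3) * L = p ^+ 3 * (u^-1 * ((p ^+ 6 - u) * L)) by rewrite /X; field.
  rewrite ler_wpM2l //; first by case/andP: P01.
  rewrite -sqrrN opprB.
  have q : (p ^+ 6 - u) ^+ 2 <= (p ^+ 6 - u) * L.
    by apply: ln_diff_mul; rewrite ?u0 ?u1 // exprn_gt0 ?exprn_ile1 // ltW.
  apply: (le_trans q); rewrite ler_peMl ?invf_ge1 //.
  by apply: le_trans q; exact: sqr_ge0.
have -> : p ^+ 3 * ((1 - ax) / x) * (p ^+ 3 * ((1 - ay) / y)) * (p ^+ 3 * ((1 - az) / z)) =
    X - X * r.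
  rewrite /X /r /u; have xn : x != 0 by rewrite gt_eqF.
  have yn : y != 0 by rewrite gt_eqF.
  have zn : z != 0 by rewrite gt_eqF.
  by field; rewrite xn yn zn.
have E1 : (X - p ^+ 3) * g <= (c^-1 ^+ 3 + 1) * (3 * (d / c)).
  apply: ler_normlW; rewrite normrM ler_pM //.
have E2 : X * r * S <= 3 * d * c^-1 ^+ 3 * (3 * H).
  apply: ler_normlW; rewrite normrM ler_pM //; case/andP: hr => r0 rd.
  by rewrite (ger0_norm (mulr_ge0 X0 r0)) mulrC ler_pM.
rewrite -/u; move: E1 E2 main; rewrite ES.
have -> : (X - X * r - p ^+ 3) * (L - g) =
  (X - p ^+ 3) * L - (X - p ^+ 3) * g - X * r * (L - g) by ring.
lra.
Qed.

(** Crude bound, polynomial in [N] when [H] is, for triples in which some value is too close to 0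
    for the truncations to be accurate. *)
Lemma excess_log_bad (R : realType) (p H : R) (N : nat) (x y z : R) :
  0 < p <= 1 ->
  (forall x, 0 <= x <= 1 -> `|(log_test p N).[x]| <= H) ->
  0 <= x <= 1 -> 0 <= y <= 1 -> 0 <= z <= 1 ->
  p ^+ 3 * (x * y * z - p ^+ 6) ^+ 2 -
    ((p ^+ 3 * (inv_poly R N).[x]) * (p ^+ 3 * (inv_poly R N).[y]) *
     (p ^+ 3 * (inv_poly R N).[z]) - p ^+ 3) *
    ((log_test p N).[x] + (log_test p N).[y] + (log_test p N).[z]) <=
  1 + (N%:R ^+ 3 + 1) * (3 * H).
Proof.
move=> /andP[p0 p1] hH hx hy hz.
have P0 : 0 <= p ^+ 3 by rewrite exprn_ge0 // ltW.
have P1 : p ^+ 3 <= 1 by rewrite exprn_ile1 // ltW.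
have hU t : 0 <= t <= 1 -> 0 <= p ^+ 3 * (inv_poly R N).[t] <= N%:R.
  move=> /(inv_poly_itv N)/andP[a b].
  by rewrite mulr_ge0 //= -[leRHS]mul1r ler_pM.
have := hH x hx; have := hH y hy; have := hH z hz.
move: (hU x hx) (hU y hy) (hU z hz).
set Ux := p ^+ 3 * _.[x]; set Uy := p ^+ 3 * _.[y]; set Uz := p ^+ 3 * _.[z].
set hx' := (log_test p N).[x]; set hy' := (log_test p N).[y]; set hz' := (log_test p N).[z].
clearbody Ux Uy Uz hx' hy' hz'.
move=> /andP[? ?] /andP[? ?] /andP[? ?] Hz Hy Hx.
have E1 : p ^+ 3 * (x * y * z - p ^+ 6) ^+ 2 <= 1.
  rewrite mulr_ile1 ?sqr_ge0 // -real_normK ?num_real // exprn_ile1 //.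
  rewrite ler_norml; case/andP: hx => ? ?; case/andP: hy => ? ?; case/andP: hz => ? ?.
  have : 0 <= x * y * z <= 1 by rewrite !mulr_ge0 //= !mulr_ile1 ?mulr_ge0.
  have : 0 <= p ^+ 6 <= 1 by rewrite exprn_ge0 ?exprn_ile1 // ltW.
  by move=> /andP[? ?] /andP[? ?]; lra.
have E2 : - ((Ux * Uy * Uz - p ^+ 3) * (hx' + hy' + hz')) <= (N%:R ^+ 3 + 1) * (3 * H).
  apply: ler_normlW; rewrite normrN normrM ler_pM //.
    apply: (le_trans (ler_normB _ _)); rewrite (ger0_norm P0) lerD // ger0_norm ?mulr_ge0 //.
    have -> : N%:R ^+ 3 = N%:R * N%:R * N%:R :> R by ring.
    by do 2![apply: ler_pM; rewrite ?mulr_ge0 //].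
  apply: (le_trans (ler_normD _ _)).
  have := ler_normD hx' hy'.
  by move: Hx Hy Hz; lra.
lra.
Qed.

(* The test function has degree and size of order N, but the error terms below decay
   geometrically, at the common rate (1 - c) ^+ N. *)
Lemma excess_log (R : realType) (p c : R) : 0 < p <= 1 -> 0 < c < 1 ->
  exists2 K : R, 0 <= K & forall (N : nat) (x y z : R), (0 < N)%N ->
  0 <= x <= 1 -> 0 <= y <= 1 -> 0 <= z <= 1 ->
  p ^+ 3 * (x * y * z - p ^+ 6) ^+ 2 <=
    ((p ^+ 3 * (inv_poly R N).[x]) * (p ^+ 3 * (inv_poly R N).[y]) *
     (p ^+ 3 * (inv_poly R N).[z]) - p ^+ 3) *
    ((log_test p N).[x] + (log_test p N).[y] + (log_test p N).[z]) +
  K * N%:R ^+ 4 * ((1 - c) ^+ N + ((1 - x) / (1 - c)) ^+ N + ((1 - y) / (1 - c)) ^+ N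
    + ((1 - z) / (1 - c)) ^+ N).
Proof.
move=> hp hc; have /andP[c0 c1] := hc.
pose B := `|2 * ln p|.
have B0 : 0 <= B by exact: normr_ge0.
have ci : 0 <= c^-1 by rewrite invr_ge0 ltW.
have ci3 : 0 <= c^-1 ^+ 3 by rewrite exprn_ge0.
(* [K1] comes from [excess_log_good] and [K2] from [excess_log_bad], both with H = N + B <= N (1 +
   B) and with all powers of N raised to N^4. *)
pose K1 := (c^-1 ^+ 3 + 1) * (3 / c) + 9 * (1 + B) * c^-1 ^+ 3.
pose K2 := 7 + 6 * B.
have K10 : 0 <= K1 by rewrite /K1 addr_ge0 // !mulr_ge0 // addr_ge0.
have K20 : 0 <= K2 by rewrite /K2; lra.
exists (K1 + K2); first by rewrite addr_ge0.
move=> N x y z N0 hx hy hz.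
have N1 : 1 <= N%:R :> R by rewrite ler1n.
have N14 : 1 <= N%:R ^+ 4 :> R by rewrite exprn_ege1.
have NN4 : N%:R <= N%:R ^+ 4 :> R by rewrite exprS ler_peMr ?exprn_ege1 // ler0n.
have N34 : N%:R ^+ 3 <= N%:R ^+ 4 :> R by rewrite [leRHS]exprS ler_peMl ?exprn_ge0.
have hH t : 0 <= t <= 1 -> `|(log_test p N).[t]| <= N%:R + B by exact: log_test_norm.
have oc : 0 < 1 - c by rewrite subr_gt0.
have q t : 0 <= t <= 1 -> 0 <= ((1 - t) / (1 - c)) ^+ N.
  by move=> /andP[? ?]; rewrite exprn_ge0 // divr_ge0 ?subr_ge0 // ltW.
have qx := q x hx; have qy := q y hy; have qz := q z hz.
have q1 t : t < c -> 1 <= ((1 - t) / (1 - c)) ^+ N.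
  by move=> tc; rewrite exprn_ege1 // ler_pdivlMr // mul1r lerB // ltW.
have qc : 0 <= (1 - c) ^+ N by rewrite exprn_ge0 // ltW.
set W := (_ + _ + _ + _ : R); rewrite -lerBlDl.
have W0 : 0 <= W by rewrite /W !addr_ge0.
have [gd|bd] := boolP [&& c <= x, c <= y & c <= z].
  have /and3P[cx cy cz] := gd.
  apply: (@le_trans _ _ (K1 * N%:R ^+ 4 * (1 - c) ^+ N)).
    apply: (le_trans (excess_log_good hp hc hH _ _ _)); rewrite ?cx ?cy ?cz.
    - by case/andP: hx.
    - by case/andP: hy.
    - by case/andP: hz.
    have -> : (c^-1 ^+ 3 + 1) * (3 * ((1 - c) ^+ N / c)) +
       3 * (1 - c) ^+ N * c^-1 ^+ 3 * (3 * (N%:R + B)) =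
      ((c^-1 ^+ 3 + 1) * (3 / c) + 9 * (N%:R + B) * c^-1 ^+ 3) * (1 - c) ^+ N by ring.
    rewrite ler_wpM2r // /K1 [leRHS]mulrDl lerD //.
      by rewrite ler_peMr // !mulr_ge0 // addr_ge0.
    rewrite [leRHS]mulrAC ler_wpM2r // -mulrA ler_wpM2l //.
    by rewrite mulrDl mul1r lerD // ler_peMr.
  apply: ler_pM => //; first by rewrite mulr_ge0 // exprn_ge0.
    by rewrite ler_wpM2r ?exprn_ge0 // lerDl.
  by rewrite /W; move: qx qy qz; lra.
(* A value t < c makes its term ((1 - t)/(1 - c))^N at least 1, so the weight [W] absorbs the crude
   bound. *)
have W1 : 1 <= W.
  rewrite /W; move: bd; rewrite !negb_and -!ltNge => /or3P[] /q1;
    by move: qx qy qz qc; lra.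
apply: (le_trans (excess_log_bad hp hH hx hy hz)).
apply: (@le_trans _ _ (K2 * N%:R ^+ 4)).
  have h1 : (N%:R ^+ 3 + 1) * (3 * (N%:R + B)) <= 2 * N%:R ^+ 3 * (3 * (N%:R * (1 + B))).
    have : N%:R + B <= N%:R * (1 + B) by rewrite mulrDr mulr1 lerD2l ler_peMl.
    have : 1 <= N%:R ^+ 3 :> R by rewrite exprn_ege1.
    move=> h2 h3; apply: ler_pM; rewrite ?mulr_ge0 ?addr_ge0 ?exprn_ge0 ?ler0n //.
      by move: h2; lra.
    by move: h3; lra.
  apply: (le_trans (lerD N14 h1)); rewrite /K2.
  have -> : 2 * N%:R ^+ 3 * (3 * (N%:R * (1 + B))) = 6 * (1 + B) * N%:R ^+ 4 by ring.
  by have := mulr_ge0 B0 (exprn_ge0 4 (ler0n R N)); move: N14; lra.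
rewrite -[leLHS]mulr1; apply: ler_pM => //; first by rewrite mulr_ge0 // exprn_ge0.
by rewrite ler_wpM2r ?exprn_ge0 // lerDr.
Qed.

(** * Choice of the truncation order and products of codegrees over triples *)

Lemma bernoulli (R : realFieldType) (s : R) (m : nat) : 0 <= s -> m%:R * s <= (1 + s) ^+ m.
Proof.
move=> s0; suff : 1 + m%:R * s <= (1 + s) ^+ m by lra.
elim: m => [|m IH]; first by rewrite mul0r addr0 expr0.
rewrite exprS; have s1 : 0 <= 1 + s by rewrite addr_ge0.
have := ler_wpM2l s1 IH; apply: le_trans; rewrite -natr1.
have : 0 <= m%:R * (s * s) by rewrite !mulr_ge0.
lra.
Qed.

(** Taking N = 5 m leaves one power of m to spare: with s = 1/q - 1, Bernoulli gives q^m m s <= 1,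
    and the fifth power of this bounds A N^4 q^N by 5^4 A / (s^5 m). *)
Lemma pow4_geom_small (R : realType) (q A d : R) : 0 < q < 1 -> 0 <= A -> 0 < d ->
  exists2 N : nat, (0 < N)%N & A * N%:R ^+ 4 * q ^+ N <= d.
Proof.
move=> /andP[q0 q1] A0 d0.
pose s := q^-1 - 1.
have s0 : 0 < s by rewrite subr_gt0 invf_gt1.
pose M := A * 625 / (s ^+ 5 * d).
have M0 : 0 <= M by rewrite divr_ge0 ?mulr_ge0 ?exprn_ge0 // ltW.
pose m := (Num.truncn M).+1.
have mM : M <= m%:R by rewrite ltW // truncnS_gt.
exists (5 * m)%N; first by rewrite muln_gt0.
have m0 : 0 < m%:R :> R by rewrite ltr0n.
have h1 : 0 <= q ^+ m * (m%:R * s) <= 1.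
  rewrite !mulr_ge0 ?exprn_ge0 ?(ltW q0) ?(ltW s0) //=.
  apply: (le_trans (ler_wpM2l (exprn_ge0 m (ltW q0)) (bernoulli m (ltW s0)))).
  by rewrite -exprMn /s subrKC mulfV ?expr1n ?gt_eqF.
have h2 : (q ^+ m * (m%:R * s)) ^+ 5 <= 1 by case/andP: h1 => *; rewrite exprn_ile1.
rewrite mulnC exprM natrM -(ler_pM2r (mulr_gt0 m0 (exprn_gt0 5 s0))).
have -> : A * (m%:R * 5) ^+ 4 * (q ^+ m) ^+ 5 * (m%:R * s ^+ 5) =
    A * 625 * (q ^+ m * (m%:R * s)) ^+ 5 by ring.
have A6 : 0 <= A * 625 by rewrite mulr_ge0.
apply: (le_trans (ler_piMr A6 h2)).
have : M * (s ^+ 5 * d) <= m%:R * (s ^+ 5 * d).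
  by rewrite ler_wpM2r // mulr_ge0 ?exprn_ge0 ?ltW.
rewrite /M divfK ?gt_eqF ?mulr_gt0 ?exprn_gt0 //.
by rewrite mulrA [X in _ <= X]mulrC.
Qed.

(** For symmetric [U] the factor [tri U] is invariant under permuting the vertices, so relabelling
    identifies the three sums. *)
Lemma sum_tri_sym (R : realFieldType) (V : finType) (U h : V -> V -> R) (a : R) :
  (forall x y, U x y = U y x) ->
  \sum_x \sum_y \sum_z (tri U x y z - a) * (h x y + h x z + h y z) =
  3 * \sum_x \sum_y \sum_z (tri U x y z - a) * h x y.
Proof.
move=> sU; pose G x y z := (tri U x y z - a) * h x y.
have -> : 3 * \sum_x \sum_y \sum_z G x y z = \sum_x \sum_y \sum_z G x y z +
    \sum_x \sum_y \sum_z G x z y + \sum_x \sum_y \sum_z G y z x.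
  have -> : \sum_x \sum_y \sum_z G x z y = \sum_x \sum_y \sum_z G x y z.
    by apply: eq_bigr => x _; rewrite exchange_big.
  have -> : \sum_x \sum_y \sum_z G y z x = \sum_x \sum_y \sum_z G x y z.
    by rewrite exchange_big; apply: eq_bigr => y _; rewrite exchange_big.
  by ring.
rewrite -!big_split; apply: eq_bigr => x _ /=.
rewrite -!big_split; apply: eq_bigr => y _ /=.
rewrite -!big_split; apply: eq_bigr => z _ /=.
by rewrite /G /tri (sU y x) (sU z x) (sU z y); ring.
Qed.

(** Summing [excess_log] over all triples bounds the squared deviations by the test sum, which
    [triple_sum_approx] makes small, plus an error sum controlled by [sum_gap_pow]. *)
Lemma codeg_triples (R : realType) (p d : R) : 0 < p <= 1 -> 0 < d ->
  exists2 eta : R, 0 < eta & forall (V : finType) (w : V -> V -> R),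
    (forall x y, 0 <= w x y <= 1) -> (0 < #|V|)%N ->
    cut_le (tri_excess p w) eta ->
    \sum_x \sum_y \sum_z (tri (codeg w) x y z - p ^+ 6) ^+ 2 <= d * #|V|%:R ^+ 3.
Proof.
move=> hp d0; have /andP[p0 p1] := hp.
have P0 : 0 < p ^+ 3 by rewrite exprn_gt0.
have P1 : p ^+ 3 <= 1 by rewrite exprn_ile1 // ltW.
(* This [c] gives 1 - p^3 <= q^2. Hence the average of ((1 - k)/q)^N, at most about (1 - p^3)^N /
   q^N, still decays like q^N. *)
pose c := p ^+ 3 / 2; pose q := 1 - c.
have hc : 0 < c < 1 by rewrite /c; apply/andP; split; lra.
have hq : 0 < q < 1 by rewrite /q /c; apply/andP; split; lra.
have /andP[q0 q1] := hq.
have [K K0 hK] := excess_log hp hc.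
pose B := `|2 * ln p|; have B0 : 0 <= B by exact: normr_ge0.
have dP : 0 < p ^+ 3 * d / 2 by rewrite divr_gt0 // mulr_gt0.
(* The coefficient of N^4 q^N in the final estimate: 9 (1 + B) from the test sum, 3 for the
   symmetrization times 3 from [triple_sum_approx], and 4 K from the four error terms of
   [excess_log]. *)
have A0 : 0 <= 9 * (1 + B) + 4 * K by lra.
have [N N0 hN] := pow4_geom_small hq A0 dP.
have N1 : 1 <= N%:R :> R by rewrite ler1n.
pose H := N%:R + B.
have H0 : 0 < H by rewrite /H; lra.
have hp' : 0 <= p <= 1 by rewrite ltW.
have [C1 C10 h1] := triple_sum_approx hp' N0 H0 (@log_test_norm R p N).
have [C2 C20 h2] := sum_gap_pow N hp'.
(* The total coefficient of [eta]. It depends on [N], so [N] is fixed first and [eta] is chosen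
   afterwards. *)
pose C := 3 * C1 + K * N%:R ^+ 4 * (3 * (C2 / q ^+ N)).
have C0 : 0 <= C.
  by rewrite /C addr_ge0 ?mulr_ge0 ?invr_ge0 ?exprn_ge0 // ltW.
exists (p ^+ 3 * d / 2 / (C + 1)); first by rewrite divr_gt0 // ltr_wpDl.
move=> V w hw n0; set eta := _ / (C + 1) => hD.
have eta0 : 0 <= eta by rewrite ltW // divr_gt0 // ltr_wpDl.
have hCe : C * eta <= p ^+ 3 * d / 2.
  have : (C + 1) * eta = p ^+ 3 * d / 2 by rewrite mulrC divfK // gt_eqF // ltr_wpDl.
  by lra.
have {}h1 := h1 V w eta hw n0 eta0 hD; have {}h2 := h2 V w eta hw n0 hD.
set n : R := #|V|%:R in h1 h2 *.
pose k := codeg w; pose U := approx_kernel p N w.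
pose F x y := (log_test p N).[k x y].
pose g x y := ((1 - k x y) / q) ^+ N.
pose b := (1 - p ^+ 3) ^+ N.
have bq : b <= q ^+ N * q ^+ N.
  rewrite -exprMn lerXn2r ?nnegrE ?subr_ge0 ?mulr_ge0 // ?(ltW q0) //.
  by have := sqr_ge0 (p ^+ 3); rewrite /q /c expr2; lra.
have hg : \sum_x \sum_y g x y <= (q ^+ N + C2 / q ^+ N * eta) * n ^+ 2.
  have -> : \sum_x \sum_y g x y = (\sum_x \sum_y (1 - k x y) ^+ N) / q ^+ N.
    rewrite mulr_suml; apply: eq_bigr => x _; rewrite mulr_suml; apply: eq_bigr => y _.
    by rewrite /g expr_div_n.
  have qN : 0 < q ^+ N by rewrite exprn_gt0.
  rewrite ler_pdivrMr //; apply: (le_trans h2); rewrite mulrAC.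
  apply: ler_wpM2r; first by rewrite exprn_ge0.
  have -> : (q ^+ N + C2 / q ^+ N * eta) * q ^+ N = q ^+ N * q ^+ N + C2 * eta.
    by field; rewrite gt_eqF.
  by rewrite lerD2r.
have hg3 : \sum_x \sum_y \sum_z (q ^+ N + g x y + g x z + g y z) <=
    (q ^+ N + 3 * (q ^+ N + C2 / q ^+ N * eta)) * n ^+ 3.
  have -> : \sum_x \sum_y \sum_z (q ^+ N + g x y + g x z + g y z) =
      n * (n * (n * q ^+ N)) + 3 * (n * \sum_x \sum_y g x y).
    have -> : 3 * (n * \sum_x \sum_y g x y) = \sum_x \sum_y \sum_(z : V) g x y +
       \sum_x \sum_(y : V) \sum_z g x z + \sum_(x : V) \sum_y \sum_z g y z.
      have E1 : n * (\sum_x \sum_y g x y) = \sum_x \sum_y \sum_(z : V) g x y.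
        rewrite mulr_sumr; apply: eq_bigr => x _; rewrite mulr_sumr; apply: eq_bigr => y _.
        by rewrite sum_const_natr mulrC.
      have -> : \sum_x \sum_(y : V) \sum_z g x z = \sum_x \sum_y \sum_(z : V) g x y.
        by apply: eq_bigr => x _; rewrite exchange_big.
      have -> : \sum_(x : V) \sum_y \sum_z g y z = \sum_x \sum_y \sum_(z : V) g x y.
        by rewrite exchange_big; apply: eq_bigr => y _; rewrite exchange_big.
      by rewrite E1; ring.
    have -> : n * (n * (n * q ^+ N)) = \sum_(x : V) \sum_(y : V) \sum_(z : V) q ^+ N.
      by rewrite !sum_const_natr /n; ring.
    rewrite !addrA -!big_split; apply: eq_bigr => x _ /=.
    rewrite -!big_split; apply: eq_bigr => y _ /=.
    by rewrite -!big_split.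
  have -> : (q ^+ N + 3 * (q ^+ N + C2 / q ^+ N * eta)) * n ^+ 3 =
    n * (n * (n * q ^+ N)) + 3 * (n * ((q ^+ N + C2 / q ^+ N * eta) * n ^+ 2)) by ring.
  by rewrite lerD2l ler_wpM2l // ler_wpM2l.
have sU x y : U x y = U y x by rewrite /U /approx_kernel codegC.
have key : p ^+ 3 * \sum_x \sum_y \sum_z (tri k x y z - p ^+ 6) ^+ 2 <=
    \sum_x \sum_y \sum_z (tri U x y z - p ^+ 3) * (F x y + F x z + F y z) +
    K * N%:R ^+ 4 * \sum_x \sum_y \sum_z (q ^+ N + g x y + g x z + g y z).
  rewrite !mulr_sumr -big_split; apply: ler_sum => x _ /=.
  rewrite !mulr_sumr -big_split; apply: ler_sum => y _ /=.
  rewrite !mulr_sumr -big_split; apply: ler_sum => z _ /=.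
  by apply: hK; rewrite ?codeg_itv.
rewrite -(ler_pM2l P0); apply: (le_trans key).
rewrite sum_tri_sym //.
have KN : 0 <= K * N%:R ^+ 4 by rewrite mulr_ge0 // exprn_ge0.
have t0 : (0 : R) <= 3 by [].
apply: (le_trans (lerD (ler_wpM2l t0 (ler_normlW h1)) (ler_wpM2l KN hg3))).
have -> : 3 * ((3 * N%:R ^+ 2 * H * (1 - p ^+ 3) ^+ N + C1 * eta) * n ^+ 3) +
    K * N%:R ^+ 4 * ((q ^+ N + 3 * (q ^+ N + C2 / q ^+ N * eta)) * n ^+ 3) =
    (9 * N%:R ^+ 2 * H * b + 4 * K * N%:R ^+ 4 * q ^+ N + C * eta) * n ^+ 3.
  by rewrite /C /b; ring.
rewrite [leRHS]mulrA; apply: ler_wpM2r; first by rewrite exprn_ge0.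
have hb : 9 * N%:R ^+ 2 * H * b <= 9 * (1 + B) * N%:R ^+ 4 * q ^+ N.
  have b1 : b <= q ^+ N.
    by apply: (le_trans bq); rewrite ler_piMl ?exprn_ge0 ?exprn_ile1 // ltW.
  have b0 : 0 <= b by rewrite exprn_ge0 // subr_ge0.
  have HN : H <= (1 + B) * N%:R by rewrite /H mulrDl mul1r lerD2l ler_peMr.
  have H2 : N%:R ^+ 2 * H <= (1 + B) * N%:R ^+ 4.
    apply: (@le_trans _ _ (N%:R ^+ 2 * ((1 + B) * N%:R))).
      by rewrite ler_wpM2l ?exprn_ge0.
    have -> : N%:R ^+ 2 * ((1 + B) * N%:R) = (1 + B) * N%:R ^+ 3 by ring.
    by rewrite ler_wpM2l ?addr_ge0 // [leRHS]exprS ler_peMl ?exprn_ge0.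
  have -> : 9 * N%:R ^+ 2 * H * b = 9 * ((N%:R ^+ 2 * H) * b) by ring.
  have -> : 9 * (1 + B) * N%:R ^+ 4 * q ^+ N = 9 * (((1 + B) * N%:R ^+ 4) * q ^+ N) by ring.
  rewrite ler_wpM2l //; apply: ler_pM => //.
  by apply: mulr_ge0; [rewrite exprn_ge0 | exact: ltW].
have := lerD (lerD hb (lexx (4 * K * N%:R ^+ 4 * q ^+ N))) hCe.
move=> hfin; apply: (le_trans hfin).
have -> : 9 * (1 + B) * N%:R ^+ 4 * q ^+ N + 4 * K * N%:R ^+ 4 * q ^+ N =
  (9 * (1 + B) + 4 * K) * N%:R ^+ 4 * q ^+ N by ring.
by move: hN; lra.
Qed.

(** * From products over triples to single codegrees *)

(** An identity on four vertices shows that k^2 is nearly constant. Its mean b then satisfies b^3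
    close to a^6, because the squared triple products are close to a^6; so k^6 is close to a^6, and
    k to a. The power a^11 is a^6 from the first steps times a^5 from the last. *)
Lemma sum_codeg_dev (R : realFieldType) (V : finType) (k : V -> V -> R) (a r : R) :
  0 < a <= 1 -> (0 < #|V|)%N -> (forall x y, 0 <= k x y <= 1) ->
  \sum_x \sum_y \sum_z `|tri k x y z - a ^+ 3| <= r * #|V|%:R ^+ 3 ->
  a ^+ 11 * \sum_x \sum_y `|k x y - a| <= 26 * r * #|V|%:R ^+ 2.
Proof.
move=> /andP[a0 a1] n0 hk hr.
set n : R := #|V|%:R in hr *.
have np : 0 < n by rewrite ltr0n.
have T01 x y z : 0 <= tri k x y z <= 1.
  have /andP[? ?] := hk x y; have /andP[? ?] := hk x z; have /andP[? ?] := hk y z.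
  by rewrite /tri !mulr_ge0 //= !mulr_ile1 ?mulr_ge0.
pose t x y z := `|tri k x y z - a ^+ 3|.
have A3 : 0 <= a ^+ 3 <= 1 by rewrite exprn_ge0 ?exprn_ile1 // ltW.
have TT x y z x' y' z' :
    `|tri k x y z * tri k x' y' z' - a ^+ 6| <= t x y z + t x' y' z'.
  have -> : tri k x y z * tri k x' y' z' - a ^+ 6 =
    (tri k x y z - a ^+ 3) * tri k x' y' z' + a ^+ 3 * (tri k x' y' z' - a ^+ 3) by ring.
  apply: (le_trans (ler_normD _ _)).
  have /norm_le1 h1 := T01 x' y' z'; have /norm_le1 h2 := A3.
  rewrite [X in X + _ <= _]normrM [X in _ + X <= _]normrM.
  by apply: lerD; [apply: ler_piMr | apply: ler_piMl].
have k2 x y : 0 <= k x y ^+ 2 <= 1.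
  by have /andP[u v] := hk x y; rewrite exprn_ge0 ?exprn_ile1.
(* k(x,y)^2 T(x,z,w) T(y,z,w) = k(z,w)^2 T(x,y,z) T(x,y,w), where all T are close to a^3 *)
have four x y z w : a ^+ 6 * `|k x y ^+ 2 - k z w ^+ 2| <=
    t x z w + t y z w + t x y z + t x y w.
  have A6 : 0 <= a ^+ 6 by rewrite exprn_ge0 // ltW.
  rewrite -{1}(ger0_norm A6) -normrM.
  have -> : a ^+ 6 * (k x y ^+ 2 - k z w ^+ 2) =
      k z w ^+ 2 * (tri k x y z * tri k x y w - a ^+ 6)
      - k x y ^+ 2 * (tri k x z w * tri k y z w - a ^+ 6).
    by rewrite /tri; ring.
  apply: (le_trans (ler_normB _ _)).
  rewrite [X in X + _ <= _]normrM [X in _ + X <= _]normrM.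
  have := TT x y z x y w; have := TT x z w y z w.
  have /norm_le1 h1 := k2 x y; have /norm_le1 h2 := k2 z w.
  have h3 := ler_piMl (normr_ge0 (tri k x z w * tri k y z w - a ^+ 6)) h1.
  have h4 := ler_piMl (normr_ge0 (tri k x y z * tri k x y w - a ^+ 6)) h2.
  by move: h3 h4; lra.
pose S := \sum_x \sum_y \sum_z t x y z.
(* Each of the four terms of [four] omits one vertex, and so contributes |V| times [S]. *)
have sum4 : a ^+ 6 * \sum_x \sum_y \sum_z \sum_w `|k x y ^+ 2 - k z w ^+ 2| <= 4 * (n * S).
  have -> : 4 * (n * S) = \sum_x \sum_(y : V) \sum_z \sum_w t x z w +
      \sum_(x : V) \sum_y \sum_z \sum_w t y z w +
      \sum_x \sum_y \sum_z \sum_(w : V) t x y z +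
      \sum_x \sum_y \sum_(z : V) \sum_w t x y w.
    have -> : \sum_x \sum_(y : V) \sum_z \sum_w t x z w = n * S.
      by rewrite exchange_big /= sum_const_natr mulrC.
    have -> : \sum_(x : V) \sum_y \sum_z \sum_w t y z w = n * S.
      by rewrite sum_const_natr mulrC.
    have -> : \sum_x \sum_y \sum_z \sum_(w : V) t x y z = n * S.
      rewrite mulr_sumr; apply: eq_bigr => x _; rewrite mulr_sumr; apply: eq_bigr => y _.
      by rewrite mulr_sumr; apply: eq_bigr => z _; rewrite sum_const_natr mulrC.
    have -> : \sum_x \sum_y \sum_(z : V) \sum_w t x y w = n * S.
      rewrite mulr_sumr; apply: eq_bigr => x _; rewrite mulr_sumr; apply: eq_bigr => y _.
      by rewrite sum_const_natr mulrC.
    by ring.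
  rewrite !mulr_sumr -!big_split; apply: ler_sum => x _ /=.
  rewrite !mulr_sumr -!big_split; apply: ler_sum => y _ /=.
  rewrite !mulr_sumr -!big_split; apply: ler_sum => z _ /=.
  by rewrite !mulr_sumr -!big_split; apply: ler_sum => w _ /=.
pose b := (\sum_z \sum_w k z w ^+ 2) / n ^+ 2.
have b01 : 0 <= b <= 1.
  rewrite /b divr_ge0 ?exprn_ge0 ?(ltW np) ?sumr_ge0 //=; last first.
    by move=> z _; rewrite sumr_ge0 // => w _; case/andP: (k2 z w).
  rewrite ler_pdivrMr ?exprn_gt0 // mul1r expr2.
  apply: ler_sum_const => z; rewrite -[leRHS]mul1r; apply: ler_sum_const => w.
  by case/andP: (k2 z w).
pose s x y := `|k x y ^+ 2 - b|.
(* The deviation from the mean is at most the mean of the absolute differences. *)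
have sdev : a ^+ 6 * \sum_x \sum_y s x y <= 4 * r * n ^+ 2.
  have h x y : s x y <= n ^- 2 * \sum_z \sum_w `|k x y ^+ 2 - k z w ^+ 2|.
    have -> : s x y = `|n ^- 2 * \sum_z \sum_w (k x y ^+ 2 - k z w ^+ 2)|.
      rewrite /s /b; congr `|_|; under [in RHS]eq_bigr do rewrite sumrB sum_const_natr.
      rewrite sumrB sum_const_natr -/n; have : n != 0 by rewrite gt_eqF.
      by move=> ?; field.
    rewrite normrM ger0_norm ?invr_ge0 ?exprn_ge0 ?(ltW np) //.
    apply: ler_wpM2l; first by rewrite invr_ge0 exprn_ge0 // ltW.
    apply: (le_trans (ler_norm_sum _ _ _)); apply: ler_sum => z _.
    exact: ler_norm_sum.
  have : a ^+ 6 * \sum_x \sum_y s x y <=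
     n ^- 2 * (a ^+ 6 * \sum_x \sum_y \sum_z \sum_w `|k x y ^+ 2 - k z w ^+ 2|).
    rewrite mulrCA ler_wpM2l ?exprn_ge0 ?(ltW a0) //.
    rewrite mulr_sumr; apply: ler_sum => x _; rewrite mulr_sumr; apply: ler_sum => y _.
    exact: h.
  move/le_trans; apply; rewrite ler_pdivrMl ?exprn_gt0 //.
  apply: (le_trans sum4).
  have -> : n ^+ 2 * (4 * r * n ^+ 2) = 4 * (n * (r * n ^+ 3)) by ring.
  by rewrite ler_wpM2l // ler_wpM2l // ltW.
have prod3 (u v w c : R) : 0 <= u <= 1 -> 0 <= v <= 1 -> 0 <= w <= 1 -> 0 <= c <= 1 ->
    `|u * v * w - c ^+ 3| <= `|u - c| + `|v - c| + `|w - c|.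
  move=> hu hv hw hc.
  have -> : u * v * w - c ^+ 3 = (u - c) * (v * w) + c * w * (v - c) + c * c * (w - c) by ring.
  apply: (le_trans (ler_normD _ _)); apply: lerD.
    apply: (le_trans (ler_normD _ _)); apply: lerD.
      by rewrite normrM ler_piMr ?norm_mul_le1 ?norm_le1.
    by rewrite normrM ler_piMl // !norm_mul_le1 ?norm_le1.
  by rewrite normrM ler_piMl // !norm_mul_le1 ?norm_le1.
(* 14 = 3 * 4 + 2: three deviations [s], each costing 4 r, and two copies of [t]. In the same way
   the final 26 is 3 * 4 + 14. *)
have bdev : a ^+ 6 * `|b ^+ 3 - a ^+ 6| <= 14 * r.
  have h x y z : `|b ^+ 3 - a ^+ 6| <= s x y + s x z + s y z + 2 * t x y z.
    have := prod3 _ _ _ _ (k2 x y) (k2 x z) (k2 y z) b01.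
    have := TT x y z x y z.
    have -> : k x y ^+ 2 * k x z ^+ 2 * k y z ^+ 2 = tri k x y z * tri k x y z.
      by rewrite /tri; ring.
    move: (tri k x y z * tri k x y z) => T h1 h2.
    have := ler_distD T (b ^+ 3) (a ^+ 6).
    by rewrite (distrC (b ^+ 3) T); move: h1 h2; rewrite /s; lra.
  have sum3 : n ^+ 3 * `|b ^+ 3 - a ^+ 6| <= 3 * (n * \sum_x \sum_y s x y) + 2 * S.
    have -> : 3 * (n * \sum_x \sum_y s x y) = \sum_x \sum_y \sum_(z : V) s x y +
       \sum_x \sum_(y : V) \sum_z s x z + \sum_(x : V) \sum_y \sum_z s y z.
      have -> : \sum_x \sum_y \sum_(z : V) s x y = n * \sum_x \sum_y s x y.
        rewrite mulr_sumr; apply: eq_bigr => x _; rewrite mulr_sumr; apply: eq_bigr => y _.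
        by rewrite sum_const_natr mulrC.
      have -> : \sum_x \sum_(y : V) \sum_z s x z = n * \sum_x \sum_y s x y.
        by rewrite exchange_big /= sum_const_natr mulrC.
      by rewrite sum_const_natr -/n; ring.
    have -> : n ^+ 3 * `|b ^+ 3 - a ^+ 6| =
        \sum_(x : V) \sum_(y : V) \sum_(z : V) `|b ^+ 3 - a ^+ 6|.
      by rewrite !sum_const_natr -/n; ring.
    rewrite !mulr_sumr -!big_split; apply: ler_sum => x _ /=.
    rewrite !mulr_sumr -!big_split; apply: ler_sum => y _ /=.
    by rewrite !mulr_sumr -!big_split; apply: ler_sum => z _ /=.
  have n3 : 0 < n ^+ 3 by rewrite exprn_gt0.
  rewrite -(ler_pM2l n3) mulrCA.
  have A6 : 0 <= a ^+ 6 by rewrite exprn_ge0 // ltW.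
  apply: (le_trans (ler_wpM2l A6 sum3)).
  have A61 : a ^+ 6 <= 1 by rewrite exprn_ile1 // ltW.
  have S0 : 0 <= S.
    by apply: sumr_ge0 => x _; apply: sumr_ge0 => y _; apply: sumr_ge0 => z _; exact: normr_ge0.
  have h1 : a ^+ 6 * (2 * S) <= 2 * (r * n ^+ 3).
    by rewrite mulrCA ler_wpM2l //; apply: le_trans hr; rewrite ler_piMl.
  have h2 := ler_wpM2l (ltW np) sdev.
  have -> : a ^+ 6 * (3 * (n * (\sum_x \sum_y s x y)) + 2 * S) =
    3 * (n * (a ^+ 6 * (\sum_x \sum_y s x y))) + a ^+ 6 * (2 * S) by ring.
  have -> : n ^+ 3 * (14 * r) = 3 * (n * (4 * r * n ^+ 2)) + 2 * (r * n ^+ 3) by ring.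
  by apply: lerD => //; rewrite ler_wpM2l.
have pt x y : a ^+ 5 * `|k x y - a| <= 3 * s x y + `|b ^+ 3 - a ^+ 6|.
  have h1 := prod3 _ _ _ _ (k2 x y) (k2 x y) (k2 x y) b01.
  have h2 := ler_distD (b ^+ 3) (k x y ^+ 6) (a ^+ 6).
  (* In the factorization of k^6 - a^6 by k - a, the cofactor is a^5 plus nonnegative terms. *)
  have h3 : a ^+ 5 * `|k x y - a| <= `|k x y ^+ 6 - a ^+ 6|.
    have -> : k x y ^+ 6 - a ^+ 6 = (k x y - a) *
      (a ^+ 5 + k x y * (a ^+ 4 + k x y * (a ^+ 3 + k x y * (a ^+ 2 + k x y * (a + k x y))))).
      by ring.
    have k0 : 0 <= k x y by case/andP: (hk x y).
    have q0 : 0 <= k x y * (a ^+ 4 + k x y * (a ^+ 3 + k x y * (a ^+ 2 + k x y * (a + k x y)))).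
      have an i : 0 <= a ^+ i by rewrite exprn_ge0 // ltW.
      by do 4![apply: mulr_ge0 => //; apply: addr_ge0 => //]; rewrite ?ltW // addr_ge0 // ltW.
    have a5 : 0 <= a ^+ 5 by rewrite exprn_ge0 // ltW.
    by rewrite normrM mulrC ler_wpM2l // ger0_norm ?addr_ge0 // lerDl.
  move: h1; have -> : k x y ^+ 2 * k x y ^+ 2 * k x y ^+ 2 = k x y ^+ 6 by ring.
  by rewrite /s; move: h2 h3; lra.
have -> : a ^+ 11 * (\sum_x \sum_y `|k x y - a|) =
    a ^+ 6 * (a ^+ 5 * \sum_x \sum_y `|k x y - a|) by ring.
have A6 : 0 <= a ^+ 6 by rewrite exprn_ge0 // ltW.
apply: (@le_trans _ _ (3 * (a ^+ 6 * \sum_x \sum_y s x y) +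
    (a ^+ 6 * `|b ^+ 3 - a ^+ 6|) * n ^+ 2)).
  have -> : 3 * (a ^+ 6 * \sum_x \sum_y s x y) + (a ^+ 6 * `|b ^+ 3 - a ^+ 6|) * n ^+ 2 =
     a ^+ 6 * (3 * (\sum_x \sum_y s x y) + \sum_(x : V) \sum_(y : V) `|b ^+ 3 - a ^+ 6|).
    by rewrite !sum_const_natr -/n; ring.
  rewrite ler_wpM2l // !mulr_sumr -!big_split; apply: ler_sum => x _ /=.
  by rewrite !mulr_sumr -!big_split; apply: ler_sum => y _ /=.
have -> : 26 * r * n ^+ 2 = 3 * (4 * r * n ^+ 2) + 14 * r * n ^+ 2 by ring.
apply: lerD; first by rewrite ler_wpM2l.
by rewrite ler_wpM2r // exprn_ge0 // ltW.
Qed.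

(** * From vertex subsets to weights, and from graph counts to kernels *)

(** The weighted sum is at most the L^1 norm of [f], which splits into the set where [f] is
    nonnegative and its complement. [cut_le_sets] applies this once in each variable. *)
Lemma norm_sum_sets (R : realFieldType) (V : finType) (f s : V -> R) (M : R) :
  (forall A : {set V}, `|\sum_(x in A) f x| <= M) -> (forall x, `|s x| <= 1) ->
  `|\sum_x s x * f x| <= 2 * M.
Proof.
move=> hf hs; pose A := [set x | 0 <= f x].
apply: (@le_trans _ _ (\sum_x `|f x|)).
  apply: (le_trans (ler_norm_sum _ _ _)); apply: ler_sum => x _.
  by rewrite normrM ler_piMl.
rewrite (bigID (fun x => x \in A)) /=.
have -> : \sum_(x in A) `|f x| = \sum_(x in A) f x.
  by apply: eq_bigr => x; rewrite inE => /ger0_norm.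
have -> : \sum_(x | x \notin A) `|f x| = - \sum_(x in ~: A) f x.
  rewrite -sumrN; apply: eq_big => x; first by rewrite in_setC.
  by rewrite inE -ltNge => /ltr0_norm.
have := ler_normlW (hf A); have := hf (~: A); rewrite -normrN => /ler_normlW.
lra.
Qed.

Lemma cut_le_sets (R : realFieldType) (V : finType) (D : V -> V -> R) (e : R) :
  (forall A B : {set V}, `|\sum_(x in A) \sum_(y in B) D x y| <= e * #|V|%:R ^+ 2) ->
  cut_le D (4 * e).
Proof.
move=> hD s t hs ht.
have -> : \sum_x \sum_y s x * t y * D x y = \sum_x s x * \sum_y t y * D x y.
  by apply: eq_bigr => x _; rewrite mulr_sumr; apply: eq_bigr => y _; rewrite mulrA.
have -> : 4 * e * #|V|%:R ^+ 2 = 2 * (2 * (e * #|V|%:R ^+ 2)) by ring.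
apply: norm_sum_sets hs => A.
have -> : \sum_(x in A) \sum_y t y * D x y = \sum_y t y * \sum_(x in A) D x y.
  by rewrite exchange_big; apply: eq_bigr => y _; rewrite mulr_sumr.
by apply: norm_sum_sets ht => B; rewrite exchange_big.
Qed.

Definition adj (R : realFieldType) (V : finType) (E : rel V) (x y : V) : R := (E x y)%:R.

(** The third vertex ranges over the common neighbours of the other two. This turns the triangle
    hypothesis into a bound on sums of [tri_excess] over pairs of subsets. *)
Lemma triangles_sum (R : realFieldType) (V : finType) (E : rel V) (A B : {set V}) :
  (0 < #|V|)%N ->
  (triangles E A B [set: V])%:R =
    #|V|%:R * \sum_(x in A) \sum_(y in B) adj R E x y * codeg (adj R E) x y.
Proof.
move=> n0; rewrite /triangles -sum1_card natr_sum.
transitivity (\sum_x \sum_y \sum_z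
   if (x \in A) && (y \in B) then adj R E x y * (adj R E x z * adj R E y z) else 0).
  rewrite pair_big pair_big /= big_mkcond /=; apply: eq_bigr => -[[x y] z] _ /=.
  rewrite inE inE /= /adj -!natrM !mulnb.
  by case: (x \in A); case: (y \in B); case: (E x y); case: (E x z); case: (E y z).
rewrite mulr_sumr [RHS]big_mkcond; apply: eq_bigr => x _.
case: (x \in A) => /=; last by rewrite big1 // => y _; rewrite big1.
rewrite mulr_sumr [RHS]big_mkcond; apply: eq_bigr => y _.
case: (y \in B); last by rewrite big1.
rewrite -mulr_sumr /codeg.
have : #|V|%:R != 0 :> R by rewrite pnatr_eq0 -lt0n.
by move=> ?; field.
Qed.

Lemma edges_between_sum (R : realFieldType) (V : finType) (E : rel V) (X Y : {set V}) :
  (edges_between E X Y)%:R = \sum_(x in X) \sum_(y in Y) adj R E x y.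
Proof.
rewrite /edges_between -sum1_card natr_sum pair_big /= big_mkcond [RHS]big_mkcond /=.
apply: eq_bigr => -[x y] _; rewrite inE /= /adj.
by case: (x \in X); case: (y \in Y); case: (E x y).
Qed.

Lemma sum_sets_const (R : realFieldType) (V : finType) (A B : {set V}) (c : R) :
  \sum_(x in A) \sum_(y in B) c = c * #|A|%:R * #|B|%:R.
Proof. by rewrite !sumr_const -mulrnA -mulrA -natrM mulr_natr mulnC. Qed.

(** * Choice of constants and transfer to quasirandomness *)

Theorem theorem1p2 (R : realType) (p eps : R) :
  0 < p <= 1 -> 0 < eps ->
  exists eta : R, 0 < eta /\
    forall (V : finType) (E : rel V), simple_graph E ->
      (forall A B : {set V},
         `|(triangles E A B [set: V])%:R - p ^+ 3 * #|A|%:R * #|B|%:R * #|V|%:R|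
           <= eta * #|V|%:R ^+ 3) ->
      quasirandom eps p E.
Proof.
move=> hp eps0; have /andP[p0 p1] := hp.
(* The final identity p^2 (w - p) = D - w (k - p^2) has two terms; each may contribute half of p^2
   eps. *)
pose d1 := p ^+ 2 * eps / 2.
have d10 : 0 < d1 by rewrite divr_gt0 // mulr_gt0 // exprn_gt0.
(* Chosen so that [sum_codeg_dev] with a = p^2 bounds the L^1 deviation of the codegrees by exactly
   [d1]. *)
pose r := (p ^+ 2) ^+ 11 * d1 / 26.
have r0 : 0 < r by rewrite divr_gt0 // mulr_gt0 // !exprn_gt0.
have [eta1 eta10 h1] := codeg_triples hp (divr_gt0 (mulr_gt0 r0 r0) (ltr0n R 4)).
(* The 4 is the loss in [cut_le_sets]; the bound by [d1] serves for D summed directly over X and Y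
   at the end. *)
exists (Num.min (eta1 / 4) d1); split; first by rewrite lt_min divr_gt0.
set eta := Num.min _ _ => V E [_ _ n0] hT X Y.
have eta1' : 4 * eta <= eta1.
  have : eta <= eta1 / 4 by rewrite ge_min lexx.
  by lra.
have etad : eta <= d1 by rewrite ge_min lexx orbT.
pose w := adj R E; pose k := codeg w; set n : R := #|V|%:R.
have np : 0 < n by rewrite ltr0n.
have hw x y : 0 <= w x y <= 1 by rewrite /w /adj ler0n lern1 leq_b1.
have hset (A B : {set V}) : `|\sum_(x in A) \sum_(y in B) tri_excess p w x y| <= eta * n ^+ 2.
  have -> : \sum_(x in A) \sum_(y in B) tri_excess p w x y =
     n^-1 * ((triangles E A B [set: V])%:R - p ^+ 3 * #|A|%:R * #|B|%:R * #|V|%:R).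
    rewrite (triangles_sum R) // mulrBr mulKf ?gt_eqF //.
    have -> : n^-1 * (p ^+ 3 * #|A|%:R * #|B|%:R * #|V|%:R) = p ^+ 3 * #|A|%:R * #|B|%:R.
      by rewrite -/n; have : n != 0 by [rewrite gt_eqF]; move=> ?; field.
    rewrite -sum_sets_const -sumrB; apply: eq_bigr => x _.
    by rewrite -sumrB.
  rewrite normrM gtr0_norm ?invr_gt0 // ler_pdivrMl //.
  by apply: (le_trans (hT A B)); rewrite le_eqVlt; apply/orP; left; apply/eqP; rewrite -/n; ring.
have hcut : cut_le (tri_excess p w) eta1.
  exact: cut_leW (cut_le_sets hset) (fun _ _ => erefl) eta1'.
have hk := codeg_itv hw.
have {}h1 := h1 V w hw n0 hcut.
have h2 : \sum_x \sum_y \sum_z `|tri k x y z - (p ^+ 2) ^+ 3| <= r * n ^+ 3.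
  (* This replaces Cauchy-Schwarz: u <= r/2 + 2 u^2 / r, and a mean square of at most r^2/4 then
     makes the mean of u at most r. *)
  have h x y z : `|tri k x y z - (p ^+ 2) ^+ 3| <=
      r / 2 + r^-1 * (2 * (tri k x y z - p ^+ 6) ^+ 2).
    rewrite -exprM -(real_normK (num_real (tri k x y z - p ^+ 6))).
    have := normr_ge0 (tri k x y z - p ^+ 6); move: `|tri k x y z - _| => u u0.
    rewrite -(ler_pM2l r0) mulrDr mulVKf ?gt_eqF //.
    by have := sqr_ge0 (r - 2 * u); rewrite sqrrB; nra.
  apply: (@le_trans _ _ (r / 2 * n ^+ 3 +
      r^-1 * (2 * \sum_x \sum_y \sum_z (tri k x y z - p ^+ 6) ^+ 2))).
    have -> : r / 2 * n ^+ 3 = \sum_(x : V) \sum_(y : V) \sum_(z : V) (r / 2).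
      by rewrite !sum_const_natr -/n; ring.
    rewrite !mulr_sumr -!big_split; apply: ler_sum => x _ /=.
    rewrite !mulr_sumr -!big_split; apply: ler_sum => y _ /=.
    by rewrite !mulr_sumr -!big_split; apply: ler_sum => z _ /=.
  have -> : r * n ^+ 3 = r / 2 * n ^+ 3 + r^-1 * (2 * (r * r / 4 * n ^+ 3)).
    by field; rewrite gt_eqF.
  by rewrite lerD2l ler_wpM2l ?invr_ge0 ?(ltW r0) // ler_wpM2l.
have p2 : 0 < p ^+ 2 <= 1 by rewrite exprn_gt0 ?exprn_ile1 // ltW.
have h3 := sum_codeg_dev p2 n0 hk h2.
have {}h3 : \sum_x \sum_y `|k x y - p ^+ 2| <= d1 * n ^+ 2.
  have P11 : 0 < (p ^+ 2) ^+ 11 by rewrite !exprn_gt0.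
  rewrite -(ler_pM2l P11); apply: (le_trans h3).
  rewrite le_eqVlt; apply/orP; left; apply/eqP; rewrite /r -/n.
  by field.
rewrite (edges_between_sum R) -/w -/n.
have P2 : 0 < p ^+ 2 by rewrite exprn_gt0.
rewrite -(ler_pM2l P2) -{1}(gtr0_norm P2) -normrM.
have -> : p ^+ 2 * (\sum_(x in X) \sum_(y in Y) w x y - p * #|X|%:R * #|Y|%:R) =
   \sum_(x in X) \sum_(y in Y) tri_excess p w x y -
   \sum_(x in X) \sum_(y in Y) w x y * (k x y - p ^+ 2).
  rewrite -sum_sets_const -!sumrB mulr_sumr; apply: eq_bigr => x _.
  rewrite -!sumrB mulr_sumr; apply: eq_bigr => y _.
  by rewrite /tri_excess -/k; ring.
apply: (le_trans (ler_normB _ _)).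
have h4 : `|\sum_(x in X) \sum_(y in Y) w x y * (k x y - p ^+ 2)| <= d1 * n ^+ 2.
  apply: le_trans h3; apply: (le_trans (ler_norm_sum _ _ _)).
  rewrite big_mkcond; apply: ler_sum => x _.
  have S0 : 0 <= \sum_y `|k x y - p ^+ 2| by rewrite sumr_ge0.
  case: (x \in X) => //; apply: (le_trans (ler_norm_sum _ _ _)).
  rewrite big_mkcond; apply: ler_sum => y _.
  by case: (y \in Y) => //; rewrite normrM ler_piMl // norm_le1.
apply: (le_trans (lerD (hset X Y) h4)).
have : eta * n ^+ 2 <= d1 * n ^+ 2 by rewrite ler_wpM2r // exprn_ge0 // ltW.
by rewrite /d1; lra.
Qed.
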